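(* For zero-dimensional locally compact paracompact non-$\sigma$-compact spaces $X$ and $Y$ the following conditions are equivalent. (1) $(\Sigma_X,\subseteq)$ and $(\Sigma_Y,\subseteq)$ are order-isomorphic; (2) $(\Delta_X,\subseteq)$ and $(\Delta_Y,\subseteq)$ are order-isomorphic; (3) $\sigma X\setminus X$ and $\sigma Y\setminus Y$ are homeomorphic.
   Context: Compact, locally compact and paracompact spaces are assumed Hausdorff. A space is zero-dimensional if its clopen subsets form an open base. $C^*(X)$ is the ring of all bounded continuous real-valued functions on $X$. For a Tychonoff space $X$ and $E\subseteq X$ let $$I_E=\big\{g\in C^*(X): |g|^{-1}\big([\epsilon,\infty)\big)\setminus E\text{ is compact for any }\epsilon>0\big\}$$ (an ideal of $C^*(X)$ when $E$ is open in $X$). Let $$\Sigma_X=\{I_U: U\text{ is a }\sigma\text{-compact clopen subset of }X\},$$ $$\Delta_X=\{I_{X\setminus U}: U\text{ is a }\sigma\text{-compact non-compact clopen subset of }X\}.$$ $\beta X$ is the Stone-Čech compactification of $X$ and $\sigma X=\bigcup\{\mathrm{cl}_{\beta X}A: A\subseteq X\text{ is }\sigma\text{-compact}\}$. Partially ordered sets are order-isomorphic if there is a bijection between them that is order-preserving with order-preserving inverse. *)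

(* Defs.v *)
From HB Require Import structures.
From mathcomp Require Import all_boot all_order all_algebra.
From mathcomp Require Import all_classical all_reals all_analysis.

Set Implicit Arguments.
Unset Strict Implicit.
Unset Printing Implicit Defensive.

Import Order.TTheory GRing.Theory Num.Theory.
Import numFieldNormedType.Exports.

Local Open Scope classical_set_scope.
Local Open Scope ring_scope.

(* The Hausdorff axiom is never part of the definitions below: it is a
   separate hypothesis ([hausdorff_space]) wherever it is needed. *)

(* The library's [zero_dimensional] only asks that distinct points be separated
   by clopen sets, which is weaker than having a base of clopen sets. *)
Definition clopen_base (X : topologicalType) : Prop :=
  forall (U : set X) (x : X), open U -> U x ->
    exists V : set X, [/\ clopen V, V x & V `<=` U].

Definition open_cover (X : topologicalType) (C : set (set X)) : Prop :=
  (forall U, C U -> open U) /\ \bigcup_(U in C) U = [set: X].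

Definition refines (X : Type) (D C : set (set X)) : Prop :=
  forall V, D V -> exists2 U, C U & V `<=` U.

Definition locally_finite (X : topologicalType) (D : set (set X)) : Prop :=
  forall x : X, exists2 N, nbhs x N &
    finite_set [set V | D V /\ V `&` N !=set0].

Definition paracompact (X : topologicalType) : Prop :=
  forall C : set (set X), open_cover C ->
    exists D : set (set X), [/\ open_cover D, refines D C & locally_finite D].

Definition sigma_compact (X : topologicalType) (A : set X) : Prop :=
  exists2 K : nat -> set X, (forall n, compact (K n)) & A = \bigcup_n K n.

Definition Cstar (R : realType) (X : topologicalType) : set (X -> R) :=
  [set f | continuous f /\ [bounded f x | x in [set: X]]].

Arguments Cstar : clear implicits.

Definition ideal_of (R : realType) (X : topologicalType) (E : set X) :
    set (X -> R) :=
  [set g | Cstar R X g /\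
    forall e : R, 0 < e -> compact ([set x | e <= `|g x|] `\` E)].

Arguments ideal_of R {X} E.

Definition Sigma_ideals (R : realType) (X : topologicalType) :
    set (set (X -> R)) :=
  [set I | exists U : set X,
    [/\ sigma_compact U, clopen U & I = ideal_of R U]].

Definition Delta_ideals (R : realType) (X : topologicalType) :
    set (set (X -> R)) :=
  [set I | exists U : set X,
    [/\ sigma_compact U, ~ compact U, clopen U & I = ideal_of R (~` U)]].

Arguments Sigma_ideals : clear implicits.
Arguments Delta_ideals : clear implicits.

Definition order_isomorphic (T U : Type) (S : set (set T)) (S' : set (set U)) :
    Prop :=
  exists (phi : set T -> set U) (psi : set U -> set T),
    [/\ forall A, S A -> S' (phi A) /\ psi (phi A) = A,
        forall B, S' B -> S (psi B) /\ phi (psi B) = B,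
        forall A A', S A -> S A' -> A `<=` A' -> phi A `<=` phi A' &
        forall B B', S' B -> S' B' -> B `<=` B' -> psi B `<=` psi B'].

Definition homeomorphic (X Y : topologicalType) : Prop :=
  exists (f : X -> Y) (g : Y -> X),
    [/\ continuous f, continuous g, cancel f g & cancel g f].

Section StoneCech.
Variables (R : realType) (X : topologicalType).

(* The product of copies of the real line indexed by C^*(X); its points are
   functions on [Cstar R X] seen as a subtype of [X -> R]. *)
Definition cube : topologicalType := {ptws Cstar R X -> R}.

Definition evaluation (x : X) : cube := fun f => set_val f x.

(* The Stone-Cech compactification, as the closure of the image of X in the
   product under evaluation, with the subspace topology. Each coordinate of
   this closure is bounded, so the factors may be R rather than compact
   intervals. The lemmas below give the defining properties: [beta] is compact
   Hausdorff, [to_beta] has dense image and every element of C^*(X) extends to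
   [beta]; [to_beta] is an embedding when X is Tychonoff. *)
Definition beta : topologicalType := set_type (closure (range evaluation)).

Lemma evaluation_closure (x : X) : evaluation x \in closure (range evaluation).
Proof. by apply/mem_set/subset_closure; exists x. Qed.

Definition to_beta (x : X) : beta :=
  exist _ (evaluation x) (evaluation_closure x).

Lemma beta_val_continuous : continuous (set_val : beta -> cube).
Proof. exact: initial_continuous. Qed.

Lemma beta_coord_continuous (f : Cstar R X) :
  continuous (fun p : beta => (set_val p : cube) f).
Proof.
move=> p; apply: (@continuous_comp beta cube R set_val (@^~ f)).
  exact: beta_val_continuous.
exact: (@proj_continuous (Cstar R X) (fun=> R : topologicalType) f).
Qed.

Lemma to_beta_continuous : continuous to_beta.
Proof.
suff ev_cont : continuous (evaluation : X -> cube).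
  move=> x U [_ [[W oW <-] Wx sWU]].
  apply: (@filterS _ _ _ (evaluation @^-1` W)).
    by move=> y Wy; apply: sWU; rewrite /= set_valE.
  by apply: ev_cont; exact: open_nbhs_nbhs.
move=> x; apply/cvg_sup => f.
move=> U /= [_ [[B oB <-] Bfx sBU]].
have [cf _] := set_valP f.
apply: (@filterS _ _ _ (set_val f @^-1` B)); first by move=> y; exact: sBU.
by apply: cf; exact: open_nbhs_nbhs.
Qed.

Lemma to_beta_dense : closure (range to_beta) = [set: beta].
Proof.
rewrite -subTset => p _ U [_ [[B oB <-] Bp sBU]].
have [q [[x _ <-] Bq]] := set_valP p B (open_nbhs_nbhs (conj oB Bp)).
by exists (to_beta x); split; [exists x|exact: sBU].
Qed.

Lemma beta_hausdorff : hausdorff_space beta.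
Proof.
move=> p q clpq; apply: val_inj; apply: functional_extensionality_dep => f.
apply: (@norm_hausdorff _ R) => A B nA nB.
have [r [Ar Br]] :=
  clpq _ _ (beta_coord_continuous nA) (beta_coord_continuous nB).
by exists ((set_val r : cube) f).
Qed.

Lemma bounded_funP (f : X -> R) :
  [bounded f x | x in [set: X]] <-> exists M : R, forall x, `|f x| <= M.
Proof.
split=> [[M [_ bM]]|[M fM]].
  by exists (M + 1) => x; apply: bM => //; rewrite ltrDl.
exists M; split; first exact: num_real.
by move=> N MN x _ /=; exact: le_trans (fM x) (ltW MN).
Qed.

Lemma closure_range_compact : compact (closure (range evaluation)).
Proof.
have /choice[M fM] : forall f : Cstar R X, exists M : R,
    forall x, `|set_val f x| <= M.
  by move=> f; have [_ /bounded_funP] := set_valP f.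
have cK : compact [set p : cube | forall f, `[- M f, M f]%classic (p f)].
  exact: (@tychonoff (Cstar R X) (fun=> R : topologicalType)
    (fun f => `[- M f, M f]%classic) (fun f => @segment_compact R _ _)).
apply: (subclosed_compact (@closed_closure _ _) cK).
have clK : closed [set p : cube | forall f, `[- M f, M f]%classic (p f)].
  apply: compact_closed cK.
  exact: (@hausdorff_product _ (fun _ : Cstar R X => R : topologicalType)).
rewrite ((closure_id _).1 clK); apply: closureS => _ [x _ <-] f /=.
by rewrite in_itv /= -ler_norml; exact: fM.
Qed.

Lemma beta_compact : compact [set: beta].
Proof.
move=> F PF _.
have FK : F (set_val @^-1` closure (range evaluation)).
  have -> : set_val @^-1` closure (range evaluation) = [set: beta].
    by rewrite -subTset => p _; exact: set_valP.
  exact: filterT.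
have [q [Kq clq]] := @closure_range_compact (set_val @ F) _ FK.
exists (exist _ q (mem_set Kq)); split=> // A U FA [_ [[B oB <-] Bq sBU]].
have FA' : (set_val @ F) (set_val @` A).
  by apply: (@filterS _ F _ A) FA => r Ar; exists r.
rewrite /= set_valE in Bq.
have [_ [[p Ap <-] Bp]] := clq _ _ FA' (open_nbhs_nbhs (conj oB Bq)).
by exists p; split=> //; exact: sBU.
Qed.

Lemma beta_extension (f : X -> R) : Cstar R X f ->
  exists2 g : beta -> R, continuous g & g \o to_beta = f.
Proof.
move=> /mem_set Cf.
exists (fun p => (set_val p : cube) (exist _ f Cf)) => //.
exact: beta_coord_continuous.
Qed.

Lemma to_beta_initial : completely_regular_space X ->
  forall U : set X, open U ->
    exists2 V : set beta, open V & to_beta @^-1` V = U.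
Proof.
move=> crX U oU.
pose W :=
  \bigcup_(V in [set V : set beta | open V /\ to_beta @^-1` V `<=` U]) V.
exists W; first by apply: bigcup_open => V [].
apply/seteqP; split=> [x [V [_ VU] Vx]|x Ux]; first exact: VU.
have [|f [cf f01 fx0 fU1]] := (@uniform_separatorP _ R [set x] (~` U)).1.
  by apply: crX; [exact: open_closedC|exact].
have Cf : Cstar R X f.
  split=> //; apply/bounded_funP; exists 1 => y.
  have /f01 : range f (f y) by exists y.
  by rewrite /= in_itv /= => /andP[f0 f1]; rewrite ger0_norm.
have [g cg gf] := beta_extension Cf.
exists (g @^-1` [set r | r < 1]).
  split; first by apply: open_comp => //; exact: open_lt.
  move=> y /=; rewrite -[g _]/((g \o to_beta) y) gf => fy1.
  apply: contrapT => nUy.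
  have /fU1 fy : (f @` (~` U)) (f y) by exists y.
  by move: fy1; rewrite fy ltxx.
rewrite /= -[g _]/((g \o to_beta) x) gf.
have /fx0 -> : (f @` [set x]) (f x) by exists x.
exact: ltr01.
Qed.

Lemma to_beta_inj : hausdorff_space X -> completely_regular_space X ->
  injective to_beta.
Proof.
move=> hX crX x y xy; apply: hX => A B.
rewrite !nbhsE => -[A' [oA A'x] sA] [B' [oB B'y] sB].
have [V oV VA] := to_beta_initial crX oA.
exists y; split; last exact: sB.
by apply: sA; move: A'x; rewrite -VA /= xy.
Qed.

(* X is identified with [range to_beta], and a subset A of X with its image. *)
Definition sigma_ext : set beta :=
  \bigcup_(A in @sigma_compact X) closure (to_beta @` A).

Definition sigma_remainder : topologicalType :=
  set_type (sigma_ext `\` range to_beta).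

End StoneCech.

Arguments beta : clear implicits.
Arguments to_beta : clear implicits.
Arguments sigma_ext : clear implicits.
Arguments sigma_remainder : clear implicits.

(* Main.v *)
Require Import Defs.
From mathcomp Require Import all_boot all_order all_algebra.
From mathcomp Require Import all_classical all_reals all_analysis.

Set Implicit Arguments.
Unset Strict Implicit.
Unset Printing Implicit Defensive.

Import Order.TTheory GRing.Theory Num.Theory.
Import numFieldNormedType.Exports.

Local Open Scope classical_set_scope.

(** The three conditions describe the same preorder. Let [D] be the set of
    sigma-compact clopen subsets of [X], preordered by: [U `\` V] is compact.

    Testing an inclusion of ideals on indicator functions shows that the ideal
    of [U] is included in that of [V] exactly when [U `\` V] is compact, for
    clopen [U] and [V] ([ideal_of_subset]). So the ideals of the first condition
    form the partial order associated with [D]. Passing to complements reverses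
    the preorder, so the ideals of the second condition form its opposite once
    the least elements, which are the compact sets, are removed. An order
    isomorphism preserves least elements and extends over them; this gives the
    equivalence of the first two conditions ([Sigma_Delta_ideals_isomorphic]).

    A clopen [U] has a clopen closure in the Stone-Cech compactification, since
    its indicator function extends. Let the trace of [U] be the part of this
    closure in the remainder of [X] inside its sigma-extension. For [U] and [V]
    in [D], the trace of [U] is included in that of [V] exactly when [U `\` V]
    is compact ([trace_subset]), and the traces of members of [D] are exactly the
    compact open sets of the remainder, where they form a base
    ([compact_open_trace], [trace_base]). So [D] also presents the partial order
    of compact open sets of the remainder. Two facts about [X] are used here:
    by paracompactness, sigma-compact sets lie in sigma-compact clopen sets
    ([sigma_compact_sub_clopen]); and a closed set can be separated by a clopen
    set from the complement of an open neighbourhood inside a sigma-compact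
    clopen set, because the latter is a countable disjoint union of compact
    open sets ([sigma_compact_clopen_between]).

    Finally, a Hausdorff space with a base of compact open sets is determined up
    to homeomorphism by the partial order of its compact open sets, which is
    Stone duality for generalized Boolean algebras
    ([homeomorphic_of_compact_open], [compact_open_of_homeomorphic]). *)

(** * Equivalence of preorders *)

(** One half of an equivalence; the other half exchanges [f] and [g]. *)
Definition preorder_retract {A B : Type} (D : set A) (r : A -> A -> Prop)
    (E : set B) (s : B -> B -> Prop) (f : A -> B) (g : B -> A) : Prop :=
  (forall a, D a -> [/\ E (f a), r a (g (f a)) & r (g (f a)) a]) /\
  (forall a a', D a -> D a' -> r a a' -> s (f a) (f a')).

(** Equivalence of preorders as categories; it says that the associated
    partially ordered sets are isomorphic, without forming quotients. *)
Definition preorder_equiv {A B : Type} (D : set A) (r : A -> A -> Prop)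
    (E : set B) (s : B -> B -> Prop) : Prop :=
  exists (f : A -> B) (g : B -> A),
    preorder_retract D r E s f g /\ preorder_retract E s D r g f.

Definition opposite {A : Type} (r : A -> A -> Prop) (a b : A) : Prop := r b a.

Lemma preorder_equiv_opposite {A B : Type} (D : set A) (r : A -> A -> Prop)
    (E : set B) (s : B -> B -> Prop) :
  preorder_equiv D r E s -> preorder_equiv D (opposite r) E (opposite s).
Proof.
move=> [f [g [[fE fm] [gD gm]]]]; exists f, g; split; split.
- by move=> a /fE[].
- by move=> a a' Da Da'; exact: fm.
- by move=> b /gD[].
- by move=> b b' Eb Eb'; exact: gm.
Qed.

Definition transitive_on {A : Type} (D : set A) (r : A -> A -> Prop) : Prop :=
  forall a b c, D a -> D b -> D c -> r a b -> r b c -> r a c.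

Definition non_least {A : Type} (D : set A) (r : A -> A -> Prop) (a0 : A) :
    set A := [set a | D a /\ ~ r a a0].

(** Equivalences match least elements with least elements. *)
Lemma preorder_retract_non_least {A B : Type} (D : set A)
    (r : A -> A -> Prop) (E : set B) (s : B -> B -> Prop) (a0 : A) (b0 : B)
    (f : A -> B) (g : B -> A) :
  transitive_on D r ->
  D a0 -> E b0 -> (forall b, E b -> s b0 b) ->
  preorder_retract D r E s f g -> preorder_retract E s D r g f ->
  preorder_retract (non_least D r a0) r (non_least E s b0) s f g.
Proof.
move=> rT Da0 Eb0 b0min [fE fm] [gD gm]; split; last first.
  by move=> a a' [Da _] [Da' _]; exact: fm.
move=> a [Da na]; have [Efa h1 h2] := fE _ Da; split=> //; split=> // fab.
apply: na; have [Efa0 k1 k2] := fE _ Da0.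
have [[Dgfa _ _] [Dgb0 _ _]] := (gD _ Efa, gD _ Eb0).
have [Dgfa0 _ _] := gD _ Efa0.
apply: (rT a (g (f a)) a0) => //; apply: (rT (g (f a)) (g (f a0)) a0) => //.
apply: (rT (g (f a)) (g b0) (g (f a0))) => //; first exact: gm.
by apply: gm => //; exact: b0min.
Qed.

Definition extend_least {A B : Type} (r : A -> A -> Prop) (a0 : A) (b0 : B)
    (f : A -> B) (a : A) : B :=
  if `[< r a a0 >] then b0 else f a.

Lemma preorder_retract_extend_least {A B : Type} (D : set A)
    (r : A -> A -> Prop) (E : set B) (s : B -> B -> Prop) (a0 : A) (b0 : B)
    (f : A -> B) (g : B -> A) :
  transitive_on D r ->
  D a0 -> E b0 -> (forall a, D a -> r a0 a) -> (forall b, E b -> s b0 b) ->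
  preorder_retract (non_least D r a0) r (non_least E s b0) s f g ->
  preorder_retract D r E s (extend_least r a0 b0 f) (extend_least s b0 a0 g).
Proof.
move=> rT Da0 Eb0 a0min b0min [fE fm].
have E0 a : D a -> E (extend_least r a0 b0 f a).
  rewrite /extend_least; case: asboolP => // na Da.
  by have [[]] := fE a (conj Da na).
split=> [a Da|a a' Da Da' aa'].
  split; first exact: E0.
  - rewrite /extend_least; case: (asboolP (r a a0)) => [ra|na].
      by rewrite asboolT //; exact: b0min.
    by have [[Ef nf] ? ?] := fE a (conj Da na); rewrite asboolF.
  - rewrite /extend_least; case: (asboolP (r a a0)) => [ra|na].
      by rewrite asboolT; [exact: a0min|exact: b0min].
    by have [[Ef nf] ? ?] := fE a (conj Da na); rewrite asboolF.
rewrite {1}/extend_least; case: asboolP => na; first exact/b0min/E0.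
have na' : ~ r a' a0 by move=> ra'; apply: na; apply: (rT a a' a0).
by rewrite /extend_least asboolF //; exact: fm.
Qed.

(** An equivalence of the preorders without their least elements extends by
    sending all least elements to a chosen one. *)
Lemma preorder_equiv_non_least {A B : Type} (D : set A)
    (r : A -> A -> Prop) (E : set B) (s : B -> B -> Prop) (a0 : A) (b0 : B) :
  transitive_on D r -> transitive_on E s ->
  D a0 -> (forall a, D a -> r a0 a) -> E b0 -> (forall b, E b -> s b0 b) ->
  preorder_equiv D r E s <->
  preorder_equiv (non_least D r a0) r (non_least E s b0) s.
Proof.
move=> rT sT Da0 a0min Eb0 b0min; split=> -[f [g [hf hg]]].
  exists f, g; split; exact: preorder_retract_non_least.
exists (extend_least r a0 b0 f), (extend_least s b0 a0 g).
by split; exact: preorder_retract_extend_least.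
Qed.

(** A family of sets indexed by a preorder [D], with inclusion of the members
    given by the preorder, is the partial order associated with [D]. *)
Lemma order_isomorphic_image {A B : pointedType} {T U : Type}
    (D : set A) (r : A -> A -> Prop) (F : A -> set T)
    (E : set B) (s : B -> B -> Prop) (G : B -> set U) :
  (forall a a', D a -> D a' -> F a `<=` F a' <-> r a a') ->
  (forall b b', E b -> E b' -> G b `<=` G b' <-> s b b') ->
  order_isomorphic (F @` D) (G @` E) <-> preorder_equiv D r E s.
Proof.
move=> Fr Gs.
pose iF (P : set T) := get [set a | D a /\ F a = P].
pose iG (Q : set U) := get [set b | E b /\ G b = Q].
have iFP P : (F @` D) P -> D (iF P) /\ F (iF P) = P.
  by move=> [a Da FaP]; apply: (@getPex _ [set a | D a /\ F a = P]); exists a.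
have iGP Q : (G @` E) Q -> E (iG Q) /\ G (iG Q) = Q.
  by move=> [b Eb GbQ]; apply: (@getPex _ [set b | E b /\ G b = Q]); exists b.
have imF a : D a -> (F @` D) (F a) by exists a.
have imG b : E b -> (G @` E) (G b) by exists b.
split=> [[phi [psi [phiE psiD phim psim]]]|[f [g [[fE fm] [gD gm]]]]].
  have phiG a : D a -> E (iG (phi (F a))) /\ G (iG (phi (F a))) = phi (F a).
    by move=> /imF/phiE[/iGP].
  have psiF b : E b -> D (iF (psi (G b))) /\ F (iF (psi (G b))) = psi (G b).
    by move=> /imG/psiD[/iFP].
  exists (fun a => iG (phi (F a))), (fun b => iF (psi (G b))).
  split; split.
  - move=> a Da; have [Ea Ga] := phiG _ Da; have [Db Fb] := psiF _ Ea.
    have FF : F (iF (psi (G (iG (phi (F a)))))) = F a.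
      by rewrite Fb Ga; have [] := phiE _ (imF _ Da).
    by split=> //; apply/Fr => //; rewrite FF.
  - move=> a a' Da Da' aa'; have [Ea Ga] := phiG _ Da.
    have [Ea' Ga'] := phiG _ Da'; apply/Gs => //; rewrite Ga Ga'.
    by apply: phim; [exact: imF|exact: imF|exact/Fr].
  - move=> b Eb; have [Db Fb] := psiF _ Eb; have [Ea Ga] := phiG _ Db.
    have GG : G (iG (phi (F (iF (psi (G b)))))) = G b.
      by rewrite Ga Fb; have [] := psiD _ (imG _ Eb).
    by split=> //; apply/Gs => //; rewrite GG.
  - move=> b b' Eb Eb' bb'; have [Db Fb] := psiF _ Eb.
    have [Db' Fb'] := psiF _ Eb'; apply/Fr => //; rewrite Fb Fb'.
    by apply: psim; [exact: imG|exact: imG|exact/Gs].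
exists (fun P => G (f (iF P))), (fun Q => F (g (iG Q))).
have mf P P' : (F @` D) P -> (F @` D) P' -> P `<=` P' ->
    G (f (iF P)) `<=` G (f (iF P')).
  move=> /iFP[Da FaP] /iFP[Da' FaP'] PP'.
  have [[Eb _ _] [Eb' _ _]] := (fE _ Da, fE _ Da').
  by apply/Gs => //; apply: fm => //; apply/Fr => //; rewrite FaP FaP'.
have mg Q Q' : (G @` E) Q -> (G @` E) Q' -> Q `<=` Q' ->
    F (g (iG Q)) `<=` F (g (iG Q')).
  move=> /iGP[Eb GbQ] /iGP[Eb' GbQ'] QQ'.
  have [[Da _ _] [Da' _ _]] := (gD _ Eb, gD _ Eb').
  by apply/Fr => //; apply: gm => //; apply/Gs => //; rewrite GbQ GbQ'.
split=> // [P /iFP[Da FaP]|Q /iGP[Eb GbQ]].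
- have [Eb h1 h2] := fE _ Da; split; first exact: imG.
  have [Eb' Gb'] := iGP _ (imG _ Eb).
  have [Da' _ _] := gD _ Eb'; have [Db' _ _] := gD _ Eb.
  rewrite -[RHS]FaP; apply/seteqP; split.
    apply: (@subset_trans _ (F (g (f (iF P))))); last exact/Fr.
    by apply/Fr => //; apply: gm => //; apply/Gs => //; rewrite Gb'.
  apply: (@subset_trans _ (F (g (f (iF P))))); first exact/Fr.
  by apply/Fr => //; apply: gm => //; apply/Gs => //; rewrite Gb'.
- have [Da h1 h2] := gD _ Eb; split; first exact: imF.
  have [Da' Fa'] := iFP _ (imF _ Da).
  have [Eb' _ _] := fE _ Da'; have [Ea' _ _] := fE _ Da.
  rewrite -[RHS]GbQ; apply/seteqP; split.
    apply: (@subset_trans _ (G (f (g (iG Q))))); last exact/Gs.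
    by apply/Gs => //; apply: fm => //; apply/Fr => //; rewrite Fa'.
  apply: (@subset_trans _ (G (f (g (iG Q))))); first exact/Gs.
  by apply/Gs => //; apply: fm => //; apply/Fr => //; rewrite Fa'.
Qed.

(** * Compact sets *)

(** Induction over a compact set: a property inherited by subsets and finite
    unions holds as soon as it holds locally. Otherwise the sets whose
    complement in [K] satisfies [P] would form a proper filter without cluster
    point in [K]. *)
Lemma compact_induction {X : topologicalType} (K : set X)
    (P : set X -> Prop) :
  compact K -> P set0 -> (forall A B, A `<=` B -> P B -> P A) ->
  (forall A B, P A -> P B -> P (A `|` B)) ->
  (forall x, K x -> exists2 N, nbhs x N & P N) -> P K.
Proof.
move=> cK P0 Psub PU Ploc; apply: contrapT => nPK.
pose F : set_system X := [set A | P (K `\` A)].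
have FF : Filter F.
  split; rewrite /F /=.
  - by rewrite setDT.
  - move=> A B PA PB; suff : P (K `\` (A `&` B)) by [].
    by rewrite setDIr; exact: PU.
  - by move=> A B AB; apply: Psub; exact: setDS.
have PF : ProperFilter F by split=> //; rewrite /F /= setD0.
have [|x [Kx clx]] := cK F PF; first by rewrite /F /= setDv.
have [N nN PN] := Ploc _ Kx.
have FN : F (~` N) by apply: Psub PN; rewrite setDE setCK; exact: subIsetr.
by have [y [nNy Ny]] := clx _ _ FN nN.
Qed.

Lemma compact_preimage_initial {X Y : topologicalType} (f : X -> Y)
    (B : set X) :
  (forall U : set X, open U -> exists2 V : set Y, open V & f @^-1` V = U) ->
  compact (f @` B) -> compact B.
Proof.
move=> finit cB F PF FB.
have [|_ [[x Bx <-] clx]] := cB (f @ F) _.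
  by apply: (@filterS _ F _ B) FB => x Bx; exists x.
exists x; split=> // A N FA.
rewrite nbhsE => -[U [oU Ux] UN].
have [V oV VU] := finit _ oU.
have FA' : (f @ F) (f @` A) by apply: (@filterS _ F _ A) FA => a Aa; exists a.
have nV : nbhs (f x) V.
  by apply: open_nbhs_nbhs; split=> //; move: Ux; rewrite -VU.
have [_ [[a Aa <-] Va]] := clx _ _ FA' nV.
by exists a; split=> //; apply: UN; rewrite -VU.
Qed.

Definition compact_open {X : topologicalType} : set (set X) :=
  [set V | compact V /\ open V].

Definition compact_open_base (X : topologicalType) : Prop :=
  forall (U : set X) (x : X), open U -> U x ->
    exists V : set X, [/\ compact_open V, V x & V `<=` U].

Lemma compact_open0 (X : topologicalType) : compact_open (set0 : set X).
Proof. by split; [exact: compact0|exact: open0]. Qed.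

Lemma compact_openU {X : topologicalType} (A B : set X) :
  compact_open A -> compact_open B -> compact_open (A `|` B).
Proof. by move=> [? ?] [? ?]; split; [exact: compactU|exact: openU]. Qed.

Lemma compact_openI {X : topologicalType} (A B : set X) :
  hausdorff_space X -> compact_open A -> compact_open B ->
  compact_open (A `&` B).
Proof.
move=> hX [cA oA] [cB oB]; split; last exact: openI.
by apply: compact_closedI => //; exact: compact_closed.
Qed.

Lemma compact_openD {X : topologicalType} (A B : set X) :
  hausdorff_space X -> compact_open A -> compact_open B ->
  compact_open (A `\` B).
Proof.
move=> hX [cA oA] [cB oB]; rewrite setDE; split.
  by apply: compact_closedI => //; exact: open_closedC.
by apply: openI => //; apply: closed_openC; exact: compact_closed.
Qed.

Lemma compact_open_clopen {X : topologicalType} (A : set X) :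
  hausdorff_space X -> compact_open A -> clopen A.
Proof. by move=> hX [cA oA]; split=> //; exact: compact_closed. Qed.

Lemma compact_open_between {X : topologicalType} (K U : set X) :
  compact_open_base X -> compact K -> open U -> K `<=` U ->
  exists C, [/\ compact_open C, K `<=` C & C `<=` U].
Proof.
move=> bX cK oU KU.
apply: (@compact_induction _ K (fun A => exists C,
    [/\ compact_open C, A `<=` C & C `<=` U])) => //.
- by exists set0; split; [exact: compact_open0|exact: sub0set|exact: sub0set].
- by move=> A B AB [C [? BC ?]]; exists C; split=> //; exact: subset_trans BC.
- move=> A B [C [? ? ?]] [C' [? ? ?]]; exists (C `|` C').
  split; [exact: compact_openU|exact: setUSS|by rewrite subUset].
- move=> x /KU Ux; have [V [coV Vx VU]] := bX _ _ oU Ux.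
  exists V; last by exists V; split.
  by apply: open_nbhs_nbhs; split=> //; case: coV.
Qed.

(** * Compact open sets determine the space *)

(** One half of an order isomorphism between the compact open sets of two
    spaces; the other half is the same property with [phi] and [psi]
    exchanged, so that each argument below serves both directions. *)
Definition compact_open_retract {S T : topologicalType}
    (phi : set S -> set T) (psi : set T -> set S) : Prop :=
  (forall Q, compact_open Q -> compact_open (phi Q) /\ psi (phi Q) = Q) /\
  (forall Q Q', compact_open Q -> compact_open Q' -> Q `<=` Q' ->
    phi Q `<=` phi Q').

Lemma compact_open_retract0 {S T : topologicalType} (phi : set S -> set T)
    (psi : set T -> set S) :
  compact_open_retract phi psi -> compact_open_retract psi phi ->
  phi set0 = set0.
Proof.
move=> [_ phim] [psiP _]; rewrite -subset0.
have [co0 phi0] := psiP _ (compact_open0 T).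
by rewrite -phi0; apply: phim => //; exact: compact_open0.
Qed.

(** The point of [T] matching [x] is where the sets [phi Q], with [Q] a compact
    open neighbourhood of [x], meet: they are compact with the finite
    intersection property. *)
Lemma compact_open_retract_point {S T : topologicalType}
    (phi : set S -> set T) (psi : set T -> set S) (x : S) :
  hausdorff_space S -> hausdorff_space T -> compact_open_base S ->
  compact_open_retract phi psi -> compact_open_retract psi phi ->
  exists y : T, forall Q, compact_open Q -> Q x <-> phi Q y.
Proof.
move=> hS hT bS phiP psiP.
have phi0 := compact_open_retract0 phiP psiP.
have psi0 := compact_open_retract0 psiP phiP.
have [phiK phim] := phiP; have [psiK psim] := psiP.
pose D : set (set S) := [set Q | compact_open Q /\ Q x].
have [Q0 [coQ0 Q0x _]] := bS setT x openT I.
have FF : Filter (filter_from D phi).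
  apply: filter_from_filter; first by exists Q0.
  move=> Q Q' [coQ Qx] [coQ' Q'x].
  have coQQ' : compact_open (Q `&` Q') by exact: compact_openI.
  exists (Q `&` Q'); first by split.
  by rewrite subsetI; split; apply: phim.
have PF : ProperFilter (filter_from D phi).
  apply: filter_from_proper => Q [coQ Qx]; apply/set0P/eqP => phiQ0.
  have [_ psiphiQ] := phiK _ coQ.
  by move: Qx; rewrite -psiphiQ phiQ0 psi0.
have [[cphiQ0 _] _] := phiK _ coQ0.
have [|y [phiQ0y cly]] := cphiQ0 _ PF; first by exists Q0.
have Qy Q : compact_open Q -> Q x -> phi Q y.
  move=> coQ Qx; have [[cphiQ _] _] := phiK _ coQ.
  apply: (compact_closed hT cphiQ) => N nN; apply: cly nN.
  by exists Q.
exists y => Q coQ; split; first exact: Qy.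
move=> phiQy; apply: contrapT => nQx.
have coQ0Q : compact_open (Q0 `\` Q) by exact: compact_openD.
have phiQ0Qy : phi (Q0 `\` Q) y by apply: Qy => //; split.
have [cophiQ psiphiQ] := phiK _ coQ.
have [cophiQ0Q psiphiQ0Q] := phiK _ coQ0Q.
pose Z := phi Q `&` phi (Q0 `\` Q).
have coZ : compact_open Z by exact: compact_openI.
(* [psi Z] lies in the disjoint sets [Q] and [Q0 `\` Q]. *)
have psiZ0 : psi Z = set0.
  rewrite -subset0 => z psiZz.
  have Qz : Q z by rewrite -psiphiQ; apply: psim psiZz => //; exact: subIsetl.
  have : (Q0 `\` Q) z.
    by rewrite -psiphiQ0Q; apply: psim psiZz => //; exact: subIsetr.
  by case.
have [_ phipsiZ] := psiK _ coZ.
have : Z y by split=> //; exact/Qy.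
by rewrite -phipsiZ psiZ0 phi0.
Qed.

Lemma compact_open_separates {S : topologicalType} (x x' : S) :
  hausdorff_space S -> compact_open_base S ->
  (forall Q, compact_open Q -> Q x -> Q x') -> x = x'.
Proof.
move=> hS bS xx'; apply: hS => A B.
rewrite nbhsE => -[U [oU Ux] UA] nB.
have [Q [coQ Qx QU]] := bS _ _ oU Ux.
exists x'; split; last exact: nbhs_singleton.
exact: UA (QU _ (xx' _ coQ Qx)).
Qed.

Lemma compact_open_retract_continuous {S T : topologicalType}
    (phi : set S -> set T) (psi : set T -> set S) (f : S -> T) :
  compact_open_base T -> compact_open_retract psi phi ->
  (forall x Q, compact_open Q -> Q x <-> phi Q (f x)) -> continuous f.
Proof.
move=> bT [psiK _] fP x N; rewrite nbhsE => -[U [oU Ufx] UN].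
have [Q [coQ Qfx QU]] := bT _ _ oU Ufx.
have [copsiQ phipsiQ] := psiK _ coQ.
have : nbhs x (psi Q).
  apply: open_nbhs_nbhs; split; first by case: copsiQ.
  by apply/fP => //; rewrite phipsiQ.
apply: filterS => z psiQz; apply/UN/QU.
by rewrite -phipsiQ; apply/fP.
Qed.

Lemma homeomorphic_of_compact_open {S T : topologicalType} :
  hausdorff_space S -> hausdorff_space T ->
  compact_open_base S -> compact_open_base T ->
  order_isomorphic (@compact_open S) (@compact_open T) -> homeomorphic S T.
Proof.
move=> hS hT bS bT [phi [psi [phiK psiK phim psim]]].
have phiP : compact_open_retract phi psi by split.
have psiP : compact_open_retract psi phi by split.
have /choice[f fP] := fun x =>
  compact_open_retract_point x hS hT bS phiP psiP.
have /choice[g gP] := fun y =>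
  compact_open_retract_point y hT hS bT psiP phiP.
exists f, g; split.
- exact: compact_open_retract_continuous bT psiP fP.
- exact: compact_open_retract_continuous bS phiP gP.
- move=> x; apply/esym/compact_open_separates => // Q coQ Qx.
  have [cophiQ psiphiQ] := phiK _ coQ.
  by rewrite -psiphiQ; apply/gP => //; apply/fP.
- move=> y; apply/esym/compact_open_separates => // Q coQ Qy.
  have [copsiQ phipsiQ] := psiK _ coQ.
  by rewrite -phipsiQ; apply/fP => //; apply/gP.
Qed.

Lemma compact_open_of_homeomorphic {S T : topologicalType} :
  homeomorphic S T -> order_isomorphic (@compact_open S) (@compact_open T).
Proof.
move=> [f [g [cf cg fK gK]]]; exists (image^~ f), (image^~ g).
have fE (A : set S) : f @` A = g @^-1` A.
  apply/seteqP; split=> [_ [x Ax <-]|y Ay]; first by rewrite /= fK.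
  by exists (g y).
have gE (B : set T) : g @` B = f @^-1` B.
  apply/seteqP; split=> [_ [y By <-]|x Bx]; first by rewrite /= gK.
  by exists (f x).
split.
- move=> Q [cQ oQ]; split; last first.
    by rewrite gE fE; apply/seteqP; split=> x; rewrite /= fK.
  split; last by rewrite fE; apply: open_comp => // y _; exact: cg.
  by apply: continuous_compact cQ; exact: continuous_subspaceT.
- move=> Q [cQ oQ]; split; last first.
    by rewrite gE fE; apply/seteqP; split=> x; rewrite /= gK.
  split; last by rewrite gE; apply: open_comp => // y _; exact: cf.
  by apply: continuous_compact cQ; exact: continuous_subspaceT.
- by move=> A A' _ _; exact: image_subset.
- by move=> A A' _ _; exact: image_subset.
Qed.

(** * Sigma-compact clopen sets *)

Lemma compact_sigma_compact {X : topologicalType} (K : set X) :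
  compact K -> sigma_compact K.
Proof. by move=> cK; exists (fun=> K) => //; rewrite bigcup_const. Qed.

Lemma sigma_compactU {X : topologicalType} (A B : set X) :
  sigma_compact A -> sigma_compact B -> sigma_compact (A `|` B).
Proof.
move=> [K cK ->] [L cL ->]; exists (fun n => K n `|` L n).
  by move=> n; exact: compactU.
by rewrite bigcupU.
Qed.

Lemma clopenD {X : topologicalType} (A B : set X) :
  clopen A -> clopen B -> clopen (A `\` B).
Proof.
by move=> cA cB; rewrite setDE; apply: clopenI => //; exact: clopenC.
Qed.

Lemma compact_open_base_locally_compact (X : topologicalType) :
  hausdorff_space X -> clopen_base X -> locally_compact [set: X] ->
  compact_open_base X.
Proof.
move=> hX zX lX U x oU Ux.
have [K] := lX x I; rewrite withinET => nK [cK clK].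
have [||V [cV Vx VUK]] := zX (U `&` K°) x.
- by apply: openI => //; exact: open_interior.
- by split.
exists V; split=> //; last by move=> y /VUK[].
split; last by case: cV.
apply: (subclosed_compact _ cK); first by case: cV.
by move=> y /VUK[_ /interior_subset].
Qed.

Lemma locally_finite_compact {X : topologicalType} (D : set (set X))
    (K : set X) :
  locally_finite D -> compact K -> finite_set [set V | D V /\ V `&` K !=set0].
Proof.
move=> lfD cK; apply: (@compact_induction _ K
  (fun A => finite_set [set V | D V /\ V `&` A !=set0])) => //.
- by apply: sub_finite_set (finite_set0 _) => V [_ [x []]].
- move=> A B AB; apply: sub_finite_set => V [DV [x [Vx Ax]]].
  by split=> //; exists x; split=> //; exact: AB.
- move=> A B fA fB; have : finite_set ([set V | D V /\ V `&` A !=set0] `|`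
    [set V | D V /\ V `&` B !=set0]) by rewrite finite_setU.
  apply: sub_finite_set => V [DV [x [Vx [Ax|Bx]]]]; [left|right];
  by split=> //; exists x.
Qed.

Definition star {X : Type} (D : set (set X)) (A : set X) : set X :=
  \bigcup_(V in [set V | D V /\ V `&` A !=set0]) V.

(** Each member of the cover lies either inside or outside a set which is
    stable under [star]. *)
Lemma star_stable_clopen {X : topologicalType} (D : set (set X)) (A : set X) :
  open_cover D -> star D A `<=` A -> clopen A.
Proof.
move=> [oD covD] sA.
have nbhsD (x : X) : exists2 V, D V & nbhs x V.
  have [V DV Vx] : (\bigcup_(V in D) V) x by rewrite covD.
  by exists V => //; apply: open_nbhs_nbhs; split=> //; exact: oD.
split.
  rewrite openE => x Ax; have [V DV nV] := nbhsD x.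
  apply: (filterS _ nV) => y Vy; apply: sA; exists V => //; split=> //.
  by exists x; split=> //; exact: nbhs_singleton.
move=> x clAx; have [V DV nV] := nbhsD x.
have [y [Ay Vy]] := clAx _ nV.
apply: sA; exists V; last exact: nbhs_singleton.
by split=> //; exists y.
Qed.

(** In a locally finite cover by relatively compact sets, stars of compact
    sets are relatively compact, so a sigma-compact set can be closed under
    stars in countably many steps. *)
Lemma sigma_compact_sub_clopen {X : topologicalType} (A : set X) :
  compact_open_base X -> paracompact X -> sigma_compact A ->
  exists U, [/\ sigma_compact U, clopen U & A `<=` U].
Proof.
move=> bX pX [K cK ->].
have [|D [ocD rD lfD]] := pX (@compact_open X).
  split; first by move=> U [].
  rewrite -subTset => x _; have [V [coV Vx _]] := bX setT x openT I.
  by exists V.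
have starK (L : set X) : exists L', compact L -> compact L' /\ star D L `<=` L'.
  have [cL|ncL] := pselect (compact L); last by exists set0.
  have fD := locally_finite_compact lfD cL.
  have /choice[c cP] (V : set X) : exists C, D V -> compact C /\ V `<=` C.
    have [DV|nDV] := pselect (D V); last by exists set0.
    by have [C [cC _] VC] := rD _ DV; exists C.
  exists (\bigcup_(V in [set V | D V /\ V `&` L !=set0]) c V) => _; split.
    have /fin_bigcup_closedP : compact (@set0 X) /\ setU_closed (@compact X).
      by split; [exact: compact0|exact: compactU].
    by apply=> // V [/cP[]].
  by move=> x [V [DV VL] Vx]; exists V => //; have [_] := cP _ DV; exact.
have [h hP] := choice starK.
pose L n k := iter k h (K n).
have cL n k : compact (L n k).
  by elim: k => [|k IHk]; [exact: cK|have [] := hP _ IHk].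
exists (\bigcup_n \bigcup_k L n k); split.
- exists (fun m => if (unpickle m : option (nat * nat)) is Some p then
                   L p.1 p.2 else set0).
    by move=> m; case: unpickle => [p|]; [exact: cL|exact: compact0].
  apply/seteqP; split=> [x [n _ [k _ Lx]]|x [m _]].
    by exists (pickle (n, k)) => //; rewrite pickleK.
  by case: unpickle => [[n k] Lx|//]; exists n => //; exists k.
- apply: (star_stable_clopen ocD) => x [V [DV [y [Vy [n _ [k _ Ly]]]]] Vx].
  exists n => //; exists k.+1 => //; have [_] := hP _ (cL n k); apply.
  by exists V => //; split=> //; exists y.
- by move=> x [n _ Kx]; exists n => //; exists 0%N.
Qed.

Lemma sigma_compact_clopen_partition {X : topologicalType} (U : set X) :
  hausdorff_space X -> compact_open_base X -> sigma_compact U -> clopen U ->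
  exists2 D : nat -> set X, (forall n, compact_open (D n)) &
    trivIset setT D /\ U = \bigcup_n D n.
Proof.
move=> hX bX [K cK UE] [oU _].
have /choice[C CP] n : exists C, [/\ compact_open C, K n `<=` C & C `<=` U].
  apply: compact_open_between => //.
  by move=> x Kx; rewrite UE; exists n.
exists (seqDU C) => [n|].
  apply: compact_openD => //; first by have [] := CP n.
  by apply: big_ind => [||k _]; [exact: compact_open0|exact: compact_openU|
     have [] := CP k].
split; first exact: trivIset_seqDU.
rewrite -seqDU_bigcup_eq; apply/seteqP; split.
  by rewrite {1}UE => x [n _ Kx]; exists n => //; have [_ + _] := CP n; exact.
by move=> x [n _ Cx]; have [_ _] := CP n; exact.
Qed.

(** Insert a compact open set between [F `&` D n] and [W `&` D n] for each
    piece [D n] of a countable compact open partition of [U]: the union is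
    clopen because the pieces are disjoint. *)
Lemma sigma_compact_clopen_between {X : topologicalType} (U F W : set X) :
  hausdorff_space X -> compact_open_base X -> sigma_compact U -> clopen U ->
  closed F -> open W -> F `<=` W ->
  exists V, [/\ sigma_compact V, clopen V, U `&` F `<=` V & V `<=` W].
Proof.
move=> hX bX sU cU clF oW FW.
have [D coD [tD UE]] := sigma_compact_clopen_partition hX bX sU cU.
have /choice[C CP] n : exists C,
    [/\ compact_open C, F `&` D n `<=` C & C `<=` W `&` D n].
  have [cDn oDn] := coD n.
  apply: compact_open_between => //; last exact: setSI.
    by rewrite setIC; exact: compact_closedI.
  exact: openI.
have CD n : C n `<=` D n by have [_ _ +] := CP n => + x => /[apply] -[].
exists (\bigcup_n C n); split.
- by exists C => // n; have [[]] := CP n.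
- split; first by apply: bigcup_open => n _; have [[]] := CP n.
  rewrite -openC.
  have -> : ~` (\bigcup_n C n) = ~` U `|` \bigcup_n (D n `\` C n).
    apply/seteqP; split=> [x nCx|x [nUx [n _ Cx]|[n _ [Dx nCx]] [m _ Cx]]].
    + have [Ux|nUx] := pselect (U x); last by left.
      right; move: Ux; rewrite UE => -[n _ Dx]; exists n => //; split=> // Cx.
      by apply: nCx; exists n.
    + by apply: nUx; rewrite UE; exists n => //; exact: CD.
    + have mn : m = n by apply: tD => //; exists x; split=> //; exact: CD.
      by apply: nCx; rewrite -mn.
  apply: openU; first by have [] := clopenC set0 cU.
  apply: bigcup_open => n _; have [coC _ _] := CP n.
  by have [] := compact_openD hX (coD n) coC.
- move=> x [+ Fx]; rewrite UE => -[n _ Dx]; exists n => //.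
  by have [_ + _] := CP n; exact.
- by move=> x [n _ Cx]; have [_ _ /(_ _ Cx)[]] := CP n.
Qed.

(** * Clopen sets in the Stone-Cech compactification *)

Lemma closure_min {X : topologicalType} (A C : set X) :
  closed C -> A `<=` C -> closure A `<=` C.
Proof. by move=> clC AC x /(closureS AC)/clC. Qed.

Lemma indic_Cstar (R : realType) {X : topologicalType} (U : set X) :
  clopen U -> Cstar R X (\1_U)%R.
Proof.
move=> [oU cU]; split; last first.
  apply/Defs.bounded_funP; exists 1%R => x.
  by rewrite indicE; case: (_ \in _); rewrite ?normr1 ?normr0 ?ler01.
move=> x; have [Ux|nUx] := pselect (U x).
  apply: (near_cst_continuous (1%R : R)).
  apply: filterS (open_nbhs_nbhs (conj oU Ux)) => y Uy.
  by rewrite indicE mem_set.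
apply: (near_cst_continuous (0%R : R)).
apply: filterS (open_nbhs_nbhs (conj (closed_openC cU) nUx)) => y nUy.
by rewrite indicE memNset.
Qed.

(** The indicator function of [U] extends continuously to the
    compactification. *)
Lemma closure_to_beta_disjoint (R : realType) {X : topologicalType}
    (U : set X) :
  clopen U ->
  closure (to_beta R X @` U) `&` closure (to_beta R X @` (~` U)) = set0.
Proof.
move=> cU; have [g cg gE] := beta_extension (@indic_Cstar R X U cU).
have gx x : g (to_beta R X x) = (\1_U x)%R by rewrite -gE.
have clg (r : R) : closed (g @^-1` [set r]).
  by apply: closed_comp => [p _|]; [exact: cg|exact: closed_eq].
have g1 : closure (to_beta R X @` U) `<=` g @^-1` [set 1%R].
  by apply: closure_min => // _ [x Ux <-]; rewrite /= gx indicE mem_set.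
have g0 : closure (to_beta R X @` (~` U)) `<=` g @^-1` [set 0%R].
  by apply: closure_min => // _ [x nUx <-]; rewrite /= gx indicE memNset.
rewrite -subset0 => p [/g1 /= gp1 /g0 /= gp0].
by have /eqP := gp1; rewrite gp0 eq_sym oner_eq0.
Qed.

Lemma closure_to_betaC (R : realType) {X : topologicalType} (U : set X) :
  clopen U ->
  closure (to_beta R X @` (~` U)) = ~` closure (to_beta R X @` U).
Proof.
move=> cU; apply/seteqP; split=> [p nUp Up|p nUp].
  have : (closure (to_beta R X @` U) `&` closure (to_beta R X @` (~` U))) p.
    by split.
  by rewrite closure_to_beta_disjoint.
have : closure (range (to_beta R X)) p by rewrite to_beta_dense.
by rewrite -(setUv U) image_setU closureU => -[/nUp|].
Qed.

Lemma closure_to_beta_clopen (R : realType) {X : topologicalType}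
    (U : set X) : clopen U -> clopen (closure (to_beta R X @` U)).
Proof.
move=> cU; split; last exact: closed_closure.
rewrite -closedC -closure_to_betaC //; exact: closed_closure.
Qed.

Lemma closure_to_betaP (R : realType) {X : topologicalType} (U : set X)
    (x : X) : clopen U -> closure (to_beta R X @` U) (to_beta R X x) <-> U x.
Proof.
move=> cU; split=> [|Ux]; last by apply: subset_closure; exists x.
apply: contraPP => nUx.
suff : closure (to_beta R X @` (~` U)) (to_beta R X x).
  by rewrite closure_to_betaC.
by apply: subset_closure; exists x.
Qed.

Lemma compact_to_beta (R : realType) {X : topologicalType} (K : set X) :
  compact K -> closed (to_beta R X @` K).
Proof.
move=> cK; apply: compact_closed; first exact: beta_hausdorff.
apply: continuous_compact cK; apply: continuous_subspaceT.
exact: to_beta_continuous.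
Qed.

(** Compact open neighbourhoods in [X] stay open in the compactification, being
    equal to their clopen closures there. *)
Lemma range_to_beta_open (R : realType) (X : topologicalType) :
  hausdorff_space X -> compact_open_base X -> open (range (to_beta R X)).
Proof.
move=> hX bX; rewrite openE => _ [x _ <-].
have [K [coK Kx _]] := bX setT x openT I.
have [cK _] := coK.
have /closure_id clK := @compact_to_beta R X K cK.
have [oK _] := @closure_to_beta_clopen R X K (compact_open_clopen hX coK).
apply: (@filterS _ _ _ (to_beta R X @` K)).
  by move=> _ [y _ <-]; exists y.
by rewrite clK; apply: open_nbhs_nbhs; split=> //; apply/closure_to_betaP => //;
  exact: compact_open_clopen.
Qed.

(** * Traces on the remainder *)

(** The part of the closure of [U] in the Stone-Cech compactification which
    lies in the remainder. *)
Definition trace (R : realType) {X : topologicalType} (U : set X) :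
    set (sigma_remainder R X) :=
  set_val @^-1` closure (to_beta R X @` U).

Arguments trace R {X} U _.

Lemma set_val_remainder_continuous (R : realType) (X : topologicalType) :
  continuous (set_val : sigma_remainder R X -> beta R X).
Proof. exact: initial_continuous. Qed.

Lemma sigma_remainder_hausdorff (R : realType) (X : topologicalType) :
  hausdorff_space (sigma_remainder R X).
Proof.
move=> p q clpq; apply: val_inj; apply: beta_hausdorff => A B nA nB.
have [r [Ar Br]] := clpq _ _ (set_val_remainder_continuous nA)
  (set_val_remainder_continuous nB).
by exists (set_val r).
Qed.

(** The trace is the closure of [U] minus the open image of [X]; it is all of
    this difference because the closure of a sigma-compact set lies in the
    sigma-extension. *)
Lemma trace_compact_open (R : realType) (X : topologicalType) (U : set X) :
  hausdorff_space X -> compact_open_base X -> sigma_compact U -> clopen U ->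
  compact_open (trace R U).
Proof.
move=> hX bX sU cU.
have [oclU clclU] := @closure_to_beta_clopen R X U cU.
split; last first.
  by apply: open_comp => // p _; exact: set_val_remainder_continuous.
apply: (compact_preimage_initial (f := set_val)); first by [].
have -> : set_val @` trace R U =
    closure (to_beta R X @` U) `\` range (to_beta R X).
  apply/seteqP; split=> [_ [p Up <-]|q [Uq nq]].
    by split=> //; have [] := set_valP p.
  have Sq : (sigma_ext R X `\` range (to_beta R X)) q by split=> //; exists U.
  by exists (exist _ q (mem_set Sq)).
apply: (subclosed_compact _ (@beta_compact R X)) => //.
rewrite setDE; apply: closedI => //; apply: open_closedC.
exact: range_to_beta_open.
Qed.

(** Discarding [V], a point of the trace of [U] lies in the closure of
    [U `\` V], which meets the remainder unless [U `\` V] is compact. *)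
Lemma trace_subset (R : realType) (X : topologicalType) (U V : set X) :
  completely_regular_space X -> sigma_compact U -> clopen U ->
  clopen V -> trace R U `<=` trace R V <-> compact (U `\` V).
Proof.
move=> crX sU cU cV; split=> [UV|cUV p Up]; last first.
  apply: contrapT => nVp.
  have [_ nrange] := set_valP p; apply: nrange.
  have : closure (to_beta R X @` (V `|` (U `\` V))) (set_val p).
    apply: closureS Up; apply: image_subset => x Ux.
    by have [|] := pselect (V x); [left|right].
  rewrite image_setU closureU => -[/nVp//|].
  by move=> /(@compact_to_beta R X _ cUV)[x _ xp]; exists x.
have cZ : clopen (U `\` V) by exact: clopenD.
have ZU : closure (to_beta R X @` (U `\` V)) `<=` closure (to_beta R X @` U).
  by apply/closureS/image_subset; exact: subDsetl.
have Zrange : closure (to_beta R X @` (U `\` V)) `<=` range (to_beta R X).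
  move=> q Zq; apply: contrapT => nq.
  have Sq : (sigma_ext R X `\` range (to_beta R X)) q.
    by split=> //; exists U => //; exact: ZU.
  have Vq : closure (to_beta R X @` V) q.
    by apply: (UV (exist _ q (mem_set Sq))); exact: ZU.
  have : closure (to_beta R X @` (~` V)) q.
    by apply: closureS Zq; apply: image_subset => x [].
  by rewrite closure_to_betaC.
apply: (compact_preimage_initial (@to_beta_initial R X crX)).
have -> : to_beta R X @` (U `\` V) = closure (to_beta R X @` (U `\` V)).
  apply/seteqP; split; first exact: subset_closure.
  by move=> q Zq; have [x _ xq] := Zrange _ Zq; exists x => //;
    move: Zq; rewrite -xq => /closure_to_betaP; exact.
apply: (subclosed_compact _ (@beta_compact R X)) => //.
exact: closed_closure.
Qed.

Definition sigma_clopen {X : topologicalType} : set (set X) :=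
  [set U | sigma_compact U /\ clopen U].

(** Shrink [W] to a closed neighbourhood [N] of the point, which is in the
    closure of some sigma-compact clopen [U], and insert a clopen set between
    [U `&` N] and [W]. *)
Lemma trace_base (R : realType) (X : topologicalType)
    (W : set (sigma_remainder R X)) (p : sigma_remainder R X) :
  hausdorff_space X -> compact_open_base X -> paracompact X ->
  open W -> W p ->
  exists U, [/\ sigma_clopen U, trace R U p & trace R U `<=` W].
Proof.
move=> hX bX pX [W' oW' W'E] Wp.
have [[A sA Ap] _] := set_valP p.
have [U0 [sU0 cU0 AU0]] := sigma_compact_sub_clopen bX pX sA.
have U0p : closure (to_beta R X @` U0) (set_val p).
  by apply: closureS Ap; exact: image_subset.
have regp : {for (set_val p : beta R X), regular_space (beta R X)}.
  apply: (compact_regular (@beta_hausdorff R X) (@beta_compact R X)).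
  exact: filterT.
have nW' : nbhs (set_val p : beta R X) W'.
  by apply: open_nbhs_nbhs; split=> //; move: Wp; rewrite -W'E.
have [W1 nW1 W1W'] := regp _ nW'.
have [N nN NW1] := regp _ (nbhs_interior nW1).
have clN : closed (to_beta R X @^-1` closure N).
  apply: closed_comp => [x _|]; last exact: closed_closure.
  exact: to_beta_continuous.
have oW1 : open (to_beta R X @^-1` W1°).
  apply: open_comp => [x _|]; last exact: open_interior.
  exact: to_beta_continuous.
have [|U [sU cU NU UW1]] :=
  sigma_compact_clopen_between hX bX sU0 cU0 clN oW1.
  by move=> x; exact: NW1.
exists U; split=> // [B nB|q Uq].
  have [_ [[x U0x <-] [Nx Bx]]] := U0p _ (filterI nN nB).
  exists (to_beta R X x); split=> //; exists x => //; apply: NU; split=> //.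
  exact: subset_closure.
rewrite -W'E; apply: W1W'; apply: closureS Uq => _ [x Ux <-].
exact: interior_subset (UW1 _ Ux).
Qed.

Lemma sigma_remainder_base (R : realType) (X : topologicalType) :
  hausdorff_space X -> compact_open_base X -> paracompact X ->
  compact_open_base (sigma_remainder R X).
Proof.
move=> hX bX pX W p oW Wp.
have [U [[sU cU] Up UW]] := trace_base hX bX pX oW Wp.
by exists (trace R U); split=> //; exact: trace_compact_open.
Qed.

Lemma traceU (R : realType) {X : topologicalType} (U V : set X) :
  trace R (U `|` V) = trace R U `|` trace R V.
Proof. by rewrite /trace image_setU closureU preimage_setU. Qed.

(** A compact open set is a finite union of basic traces, and taking traces
    commutes with finite unions. *)
Lemma compact_open_trace (R : realType) (X : topologicalType) :
  hausdorff_space X -> compact_open_base X -> paracompact X ->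
  @compact_open (sigma_remainder R X) = trace R @` sigma_clopen.
Proof.
move=> hX bX pX; apply/seteqP; split=> [Q [cQ oQ]|_ [U [sU cU] <-]]; last first.
  exact: trace_compact_open.
have [U sU [QU UQ]] : exists2 U : set X, sigma_clopen U &
    Q `<=` trace R U /\ trace R U `<=` Q.
  apply: (@compact_induction _ Q (fun A => exists2 U : set X, sigma_clopen U &
    A `<=` trace R U /\ trace R U `<=` Q)) => //.
  - exists set0; last by split=> //; rewrite /trace image_set0 closure0.
    by split; [exact/compact_sigma_compact/compact0|exact: clopen0].
  - move=> A B AB [U sU [BU UQ]]; exists U => //; split=> //.
    exact: subset_trans BU.
  - move=> A B [U [sU cU] [AU UQ]] [V [sV cV] [BV VQ]]; exists (U `|` V).
      by split; [exact: sigma_compactU|exact: clopenU].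
    by rewrite traceU; split; [exact: setUSS|rewrite subUset].
  - move=> p Qp; have [U [sU Up UQ]] := trace_base hX bX pX oQ Qp.
    exists (trace R U); last by exists U => //; split.
    have [_ oU] := trace_compact_open R hX bX sU.1 sU.2.
    exact: open_nbhs_nbhs.
by exists U => //; apply/seteqP.
Qed.

(** * The ideals *)

Definition almost_subset {X : topologicalType} (U V : set X) : Prop :=
  compact (U `\` V).

(** Clopenness matters: it makes [U `\` W] a closed subset of a compact set. *)
Lemma almost_subset_trans {X : topologicalType} (U V W : set X) :
  clopen U -> clopen V -> clopen W ->
  almost_subset U V -> almost_subset V W -> almost_subset U W.
Proof.
move=> cU cV cW UV VW; have [_ clUW] := clopenD cU cW.
apply: subclosed_compact clUW (compactU UV VW) _.
by move=> x [Ux nWx]; have [Vx|nVx] := pselect (V x); [right|left].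
Qed.

(** The indicator function of [U] belongs to the ideal of [U], and it lies in
    the ideal of [V] only if [U `\` V] is compact. *)
Lemma ideal_of_subset (R : realType) {X : topologicalType} (U V : set X) :
  clopen U -> clopen V ->
  ideal_of R U `<=` ideal_of R V <-> almost_subset U V.
Proof.
move=> cU cV; have normU x : `|(\1_U x : R)|%R = (\1_U x)%R.
  by rewrite ger0_norm // indicE.
split=> [UV|cUV g [Cg gU]]; last first.
  split=> // e e0; have [cg _] := Cg.
  apply: subclosed_compact (compactU (gU e e0) cUV) _.
    rewrite setDE; apply: closedI; last by apply: open_closedC; case: cV.
    apply: (@closed_comp _ _ (fun x => `|g x|%R) [set y | e <= y]%R).
      by move=> x _; apply: cvg_norm; exact: cg.
    exact: closed_ge.
  by move=> x [ex nVx]; have [Ux|nUx] := pselect (U x); [right|left].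
have /UV[_ /(_ 1%R ltr01)] : ideal_of R U (\1_U)%R.
  split; first exact: indic_Cstar.
  move=> e e0; rewrite (_ : _ `\` _ = set0); first exact: compact0.
  rewrite -subset0 => x [/= + nUx].
  by rewrite normU indicE memNset //= leNgt e0.
congr compact; apply/seteqP; split=> [x [/= + nVx]|x [Ux nVx]].
  have [Ux|nUx] := pselect (U x); first by split.
  by rewrite normU indicE memNset //= ler10.
by split=> //=; rewrite normU indicE mem_set.
Qed.

Lemma Sigma_idealsE (R : realType) (X : topologicalType) :
  Sigma_ideals R X = ideal_of R @` sigma_clopen.
Proof.
apply/seteqP; split=> [I [U [sU cU ->]]|_ [U [sU cU] <-]]; exists U => //.
Qed.

Lemma non_least_sigma_clopen {X : topologicalType} (U : set X) :
  non_least sigma_clopen almost_subset set0 U <->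
  [/\ sigma_compact U, ~ compact U & clopen U].
Proof.
rewrite /non_least /almost_subset /= setD0.
by split=> [[[]]|[]]; split.
Qed.

Lemma Delta_idealsE (R : realType) (X : topologicalType) :
  Delta_ideals R X =
  (fun U => ideal_of R (~` U)) @` non_least sigma_clopen almost_subset set0.
Proof.
apply/seteqP; split=> [I [U [sU nU cU ->]]|_ [U lU <-]].
  by exists U => //; apply/non_least_sigma_clopen.
have [? ? ?] := (non_least_sigma_clopen U).1 lU.
by exists U.
Qed.

Lemma ideal_of_setC_subset (R : realType) {X : topologicalType} (U V : set X) :
  clopen U -> clopen V ->
  ideal_of R (~` U) `<=` ideal_of R (~` V) <-> opposite almost_subset U V.
Proof.
move=> cU cV; rewrite ideal_of_subset; [|exact: clopenC|exact: clopenC].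
by rewrite /opposite /almost_subset !setDE setCK setIC.
Qed.

(** * The three equivalent conditions *)

Lemma Sigma_ideals_isomorphicP (R : realType) (X Y : topologicalType) :
  order_isomorphic (Sigma_ideals R X) (Sigma_ideals R Y) <->
  preorder_equiv (@sigma_clopen X) almost_subset (@sigma_clopen Y)
    almost_subset.
Proof.
rewrite !Sigma_idealsE; apply: order_isomorphic_image.
- by move=> U V [_ cU] [_ cV]; exact: ideal_of_subset.
- by move=> U V [_ cU] [_ cV]; exact: ideal_of_subset.
Qed.

Lemma Delta_ideals_isomorphicP (R : realType) (X Y : topologicalType) :
  order_isomorphic (Delta_ideals R X) (Delta_ideals R Y) <->
  preorder_equiv (non_least (@sigma_clopen X) almost_subset set0)
    (opposite almost_subset)
    (non_least (@sigma_clopen Y) almost_subset set0) (opposite almost_subset).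
Proof.
rewrite !Delta_idealsE; apply: order_isomorphic_image.
- by move=> U V [[_ cU] _] [[_ cV] _]; exact: ideal_of_setC_subset.
- by move=> U V [[_ cU] _] [[_ cV] _]; exact: ideal_of_setC_subset.
Qed.

(** The compact clopen sets are the least elements of the preorder presenting
    the first family of ideals; the second family omits them and reverses the
    order. *)
Lemma Sigma_Delta_ideals_isomorphic (R : realType) (X Y : topologicalType) :
  order_isomorphic (Sigma_ideals R X) (Sigma_ideals R Y) <->
  order_isomorphic (Delta_ideals R X) (Delta_ideals R Y).
Proof.
have sigma0 (Z : topologicalType) : sigma_clopen (set0 : set Z).
  by split; [exact/compact_sigma_compact/compact0|exact: clopen0].
have least0 (Z : topologicalType) (U : set Z) :
    sigma_clopen U -> almost_subset set0 U.
  by move=> _; rewrite /almost_subset set0D; exact: compact0.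
have trans (Z : topologicalType) :
    transitive_on (@sigma_clopen Z) almost_subset.
  by move=> U V W [_ cU] [_ cV] [_ cW]; exact: almost_subset_trans.
rewrite Sigma_ideals_isomorphicP Delta_ideals_isomorphicP.
rewrite (preorder_equiv_non_least (trans X) (trans Y) (sigma0 X) (least0 X)
  (sigma0 Y) (least0 Y)).
by split; exact: preorder_equiv_opposite.
Qed.

(** Both partial orders are presented by sigma-compact clopen sets up to compact
    sets, the second one by way of traces. *)
Lemma Sigma_ideals_remainder (R : realType) (X Y : topologicalType) :
  hausdorff_space X -> hausdorff_space Y ->
  compact_open_base X -> compact_open_base Y ->
  completely_regular_space X -> completely_regular_space Y ->
  paracompact X -> paracompact Y ->
  order_isomorphic (Sigma_ideals R X) (Sigma_ideals R Y) <->
  order_isomorphic (@compact_open (sigma_remainder R X))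
    (@compact_open (sigma_remainder R Y)).
Proof.
move=> hX hY bX bY crX crY pX pY.
rewrite Sigma_ideals_isomorphicP !compact_open_trace //.
apply: iff_sym; apply: order_isomorphic_image.
- by move=> U V [sU cU] [_ cV]; exact: trace_subset.
- by move=> U V [sU cU] [_ cV]; exact: trace_subset.
Qed.

Theorem theorem7p6 (R : realType) (X Y : topologicalType)
  (hausX : hausdorff_space X) (hausY : hausdorff_space Y)
  (zdimX : clopen_base X) (zdimY : clopen_base Y)
  (lcptX : locally_compact [set: X]) (lcptY : locally_compact [set: Y])
  (paraX : paracompact X) (paraY : paracompact Y)
  (nsigX : ~ sigma_compact [set: X]) (nsigY : ~ sigma_compact [set: Y]) :
  let cond1 := order_isomorphic (Sigma_ideals R X) (Sigma_ideals R Y) in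
  let cond2 := order_isomorphic (Delta_ideals R X) (Delta_ideals R Y) in
  let cond3 := homeomorphic (sigma_remainder R X) (sigma_remainder R Y) in
  (cond1 <-> cond2) /\ (cond2 <-> cond3).
Proof.
move=> cond1 cond2 cond3.
have cond12 : cond1 <-> cond2 by exact: Sigma_Delta_ideals_isomorphic.
split=> //; apply: (iff_trans (iff_sym cond12)).
have bX := compact_open_base_locally_compact hausX zdimX lcptX.
have bY := compact_open_base_locally_compact hausY zdimY lcptY.
have crX := @locally_compact_completely_regular X R lcptX hausX.
have crY := @locally_compact_completely_regular Y R lcptY hausY.
rewrite /cond1 Sigma_ideals_remainder //; split.
  apply: homeomorphic_of_compact_open; [exact: sigma_remainder_hausdorff|
    exact: sigma_remainder_hausdorff|exact: sigma_remainder_base|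
    exact: sigma_remainder_base].
exact: compact_open_of_homeomorphic.
Qed.
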